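(* Let $(\Omega,\mathcal{F},\mathbb{P})$ be a probability space, $f:\mathbb{R}\to\mathbb{R}$ a non-linear function, $a>0$, $x_1\in\mathbb{R}$, and $(\xi_n)_{n\ge 1}$ a sequence of real random variables on $\Omega$ with strong mixing coefficients $\alpha(n)$. Let $(x_n)_{n\ge1}$ be defined by $$x_{n+1}=\Bigl(1-\frac{a}{n}\Bigr)x_n+\frac{a}{n}\Bigl[f(x_n)+\frac1n\,\xi_n\Bigr],\qquad n\ge 1.$$ Assume: (1) there is $c\in(0,1)$ with $|f(x)-f(y)|\le c|x-y|$ for all $x,y\in\mathbb{R}$, and $x^{\ast}$ denotes the unique fixed point of $f$; (2) there is $N$ with $0<N<+\infty$ and $|x_1-x^{\ast}|\le N$; (3) there is $p>2$ such that $\mathbb{P}\{|\xi_i|>t\}\le t^{-p}$ for all $t>0$ and all $i\ge1$; (4) there are $d\ge 1$ and $\beta>1$ such that $\alpha(n)\le d\,n^{-\beta}$ for all $n\ge1$; (5) there is $\rho>0$ with $\rho\,\frac{(\beta+1)p}{\beta+p}>2$. Then for every real $\rho>0$ such that $$\frac{2(\beta+p)}{p(\beta+1)}<\rho<a(1-c)<1,$$ we have $$x_{n+1}-x^{\ast}=\mathcal{O}\left(\frac{\sqrt{\ln n}}{n^{a(1-c)-\rho}}\right)\quad\text{almost completely.}$$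
   Context: Strong mixing coefficients: for a sequence $(\xi_i)_{i\ge1}$ of real random variables, let $\mathcal{F}_l^m$ be the $\sigma$-algebra generated by the $\xi_i$ with $l\le i\le m$ (and $\mathcal{F}_{-\infty}^k$ the one generated by all $\xi_i$ with $i\le k$, $\mathcal{F}_{l}^{+\infty}$ the one generated by all $\xi_i$ with $i\ge l$). Then $$\alpha(n)=\sup_{k}\ \sup_{A\in\mathcal{F}_{-\infty}^{k},\,B\in\mathcal{F}_{k+n}^{+\infty}}\bigl|\mathbb{P}(A\cap B)-\mathbb{P}(A)\mathbb{P}(B)\bigr|.$$ The sequence is called strong mixing ($\alpha$-mixing) if $\alpha(n)\to0$ as $n\to\infty$. Almost complete rate: for a sequence $(\epsilon_n)$ of positive reals tending to zero, and random variables $y_n$, one writes $y_n=\mathcal{O}(\epsilon_n)$ almost completely (a.co.) if there is a constant $k>0$ such that $\sum_{n=1}^{+\infty}\mathbb{P}\{|y_n|>k\,\epsilon_n\}<+\infty$. (Here it is applied with $y_n=x_{n+1}-x^{\ast}$.) *)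

(* Defs.v *)
From HB Require Import structures.
From mathcomp Require Import all_boot all_order all_algebra.
From mathcomp Require Import all_classical all_reals all_analysis.

Set Implicit Arguments.
Unset Strict Implicit.
Unset Printing Implicit Defensive.

Import Order.TTheory GRing.Theory Num.Theory.
Import numFieldNormedType.Exports.

Local Open Scope classical_set_scope.
Local Open Scope ring_scope.

(* Sequences are indexed by n >= 1: the value at index 0 is never used. *)

Definition sigma_of (d : measure_display) (T : measurableType d) (R : realType)
    (xi : nat -> T -> R) (I : set nat) : set (set T) :=
  <<s \bigcup_(i in I) preimage_set_system setT (xi i) measurable >>.

Definition past_sigma (d : measure_display) (T : measurableType d)
    (R : realType) (xi : nat -> T -> R) (k : nat) : set (set T) :=
  sigma_of xi [set i | (1 <= i <= k)%N].

Definition future_sigma (d : measure_display) (T : measurableType d)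
    (R : realType) (xi : nat -> T -> R) (l : nat) : set (set T) :=
  sigma_of xi [set i | (1 <= i)%N /\ (l <= i)%N].

(* Allowing k = 0, where the past is the trivial sigma-algebra, only adds the
   value 0 to the supremum. *)
Definition alpha_mixing (d : measure_display) (T : measurableType d)
    (R : realType) (P : probability T R) (xi : nat -> T -> R) (n : nat)
    : \bar R :=
  ereal_sup [set r | exists k A B,
    [/\ past_sigma xi k A, future_sigma xi (k + n) B &
        r = `|P (A `&` B) - P A * P B|%E]].

Definition bigO_aco (d : measure_display) (T : measurableType d)
    (R : realType) (P : probability T R) (y : nat -> T -> R) (eps : nat -> R)
    : Prop :=
  exists2 k : R, 0 < k &
    (\sum_(1 <= n <oo) P [set w | (k * eps n < `|y n w|)%R] < +oo)%E.

(* Main.v *)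
(* With b = a (1 - c) < 1, the errors e_n = |x_n - x*| satisfy
   e_{n+1} <= (1 - b / n) e_n + (a / n^2) |xi_n| for n >= a. If |xi_i| <= M for
   all i <= n, where M >= 1, comparison with M (C n^(-b) - D / n) yields
   e_{n+1} <= C M n^(-b). Taking M = n^rho, the event e_{n+1} > C n^(rho - b)
   forces |xi_i| > n^rho for some i <= n, which by the union bound has
   probability at most n^(1 - rho p); this is summable because rho p > 2. *)
Require Import Defs.
From HB Require Import structures.
From mathcomp Require Import all_boot all_order all_algebra.
From mathcomp Require Import all_classical all_reals all_analysis.
From mathcomp Require Import measurable_realfun ring lra.

Set Implicit Arguments.
Unset Strict Implicit.
Unset Printing Implicit Defensive.

Import Order.TTheory GRing.Theory Num.Theory.
Import numFieldNormedType.Exports.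

Local Open Scope classical_set_scope.
Local Open Scope ring_scope.

(** The convex function [y ^ (- b)] lies above its tangent at [x]: use [exp s >= 1 + s] and
    [ln (1 + s) <= s] on [exp (- b ln (y / x))]. It serves forwards, from [n] to [n + 1], in the
    recursion, and backwards to telescope a series. *)
Lemma powRN_tangent (R : realType) (b x y : R) : 0 <= b -> 0 < x -> 0 < y ->
  (1 - b * ((y - x) / x)) * x `^ (- b) <= y `^ (- b).
Proof.
move=> b0 x0 y0.
have -> : y `^ (- b) = (y / x) `^ (- b) * x `^ (- b).
  by rewrite -powRM ?divfK ?gt_eqF// ?ltW// divr_gt0.
rewrite ler_wpM2r ?powR_ge0// /powR gt_eqF ?divr_gt0//.
apply: le_trans (expR_ge1Dx _).
rewrite mulNr lerD2l lerN2 ler_wpM2l//.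
have -> : y / x = 1 + (y - x) / x by field; rewrite gt_eqF.
apply: le_ln1Dx.
by rewrite -subr_gt0 opprK mulrBl divff ?gt_eqF// subrK divr_gt0.
Qed.

(** * Deterministic bounds for the perturbed recursion *)

Section perturbed_contraction.
Variables (R : realType) (a c N : R).
Hypotheses (a_gt0 : 0 < a) (c_ge0 : 0 <= c).

(** The absolute value covers the finitely many [n < a], where [1 - a / n] is negative. *)
Definition perturbed_contraction (u z : nat -> R) := forall n, (1 <= n)%N ->
  u n.+1 <= (`|1 - a / n%:R| + a * c / n%:R) * u n + a / n%:R ^+ 2 * z n.

(** [G] is chosen before [u], [z] and [M], so the early steps cost a constant common to all sample
    paths; [1 <= M] lets [N] be absorbed into a multiple of [M]. *)
Lemma perturbed_contraction_growth n : exists G : R,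
  forall (u z : nat -> R) M, 1 <= M -> u 1%N <= N ->
    perturbed_contraction u z ->
    (forall i, (1 <= i <= n)%N -> z i <= M) -> u n.+1 <= G * M.
Proof.
elim: n => [|n [G IH]].
  exists `|N| => u z M M1 uN _ _.
  by rewrite (le_trans uN)// (le_trans (ler_norm _))// ler_peMr.
exists ((`|1 - a / n.+1%:R| + a * c / n.+1%:R) * G + a / n.+1%:R ^+ 2).
move=> u z M M1 uN uz zM; apply: le_trans (uz n.+1 isT) _.
rewrite [leRHS]mulrDl -[X in _ <= X + _]mulrA lerD// ler_wpM2l//.
- by rewrite addr_ge0// divr_ge0// mulr_ge0// ltW.
- by apply: (IH u z) => // i /andP[i1 ni]; apply: zM; rewrite i1 leqW.
- by rewrite divr_ge0 ?exprn_ge0// ltW.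
- by apply: zM; rewrite leqnn.
Qed.

Let b := a * (1 - c).
Hypotheses (b_ge0 : 0 <= b) (b_lt1 : b < 1).
Let D := 2 * a / (1 - b).

(* The correction - D / n absorbs the perturbation a / n ^ 2, because the
   homogeneous recursion decays like n ^ (- b) with b < 1. *)
Let potential (C : R) n : R := C * n%:R `^ (- b) - D / n%:R.

Let potential_step C n : 0 <= C -> (1 <= n)%N -> 2 / (1 - b) <= n%:R ->
  (1 - b / n%:R) * potential C n + a / n%:R ^+ 2 <= potential C n.+1.
Proof.
move=> C0 n1 nb.
have n0 : 0 < n%:R :> R by rewrite ltr0n.
have b1 : 0 < 1 - b by rewrite subr_gt0.
have tangent : C * ((1 - b / n%:R) * n%:R `^ (- b)) <= C * n.+1%:R `^ (- b).
  rewrite ler_wpM2l//.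
  have := @powRN_tangent R b n%:R n.+1%:R b_ge0 n0 (ltr0Sn _ _).
  by rewrite -(@natr1 _ n) [_ + 1 - _]addrC addKr mul1r.
suff key : a / n%:R ^+ 2 + D / n.+1%:R <= (1 - b / n%:R) * (D / n%:R).
  by rewrite /potential mulrBr mulrCA -addrA lerD// addrC lerBlDr addrC lerBrDr.
rewrite -subr_ge0 -(@natr1 _ n).
(* Since [D (1 - b) = 2 a], the correction gains [2 a / n ^ 2] to leading order, twice the
   perturbation; the surplus pays for the lower-order terms once [n >= 2 / (1 - b)]. *)
have -> : (1 - b / n%:R) * (D / n%:R) - (a / n%:R ^+ 2 + D / (n%:R + 1)) =
    a / (1 - b) / (n%:R ^+ 2 * (n%:R + 1)) * ((1 - b) * (n%:R + 1) - 2).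
  by rewrite /D; field; rewrite !gt_eqF.
rewrite mulr_ge0//.
  have n0' := ltW n0.
  apply: divr_ge0; first exact: divr_ge0 (ltW a_gt0) (ltW b1).
  by rewrite mulr_ge0 ?exprn_ge0 ?addr_ge0.
by move: nb; rewrite ler_pdivrMr//; lra.
Qed.

(** Induction against the supersolution [potential C n * M]. That [C] and [n0] serve every [M] is
    what allows [M] to grow with [n] later. *)
Lemma perturbed_contraction_rate : exists C n0, 0 < C /\
  forall (u z : nat -> R) M n, 1 <= M -> u 1%N <= N ->
    perturbed_contraction u z ->
    (n0 <= n)%N -> (forall i, (1 <= i <= n)%N -> z i <= M) ->
    u n.+1 <= C * M * n%:R `^ (- b).
Proof.
have b1 : 0 < 1 - b by rewrite subr_gt0.
have D0 : 0 < D by rewrite /D divr_gt0// mulr_gt0.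
(* Beyond [a] the factor [1 - a / k] is nonnegative; beyond [2 / (1 - b)] the step of the potential
   applies. *)
pose m := (Num.truncn (a + 2 / (1 - b))).+1.
have mab : a + 2 / (1 - b) < m%:R by apply: truncnS_gt.
have [G HG] := perturbed_contraction_growth m.
have m0 : 0 < m.+1%:R :> R by rewrite ltr0Sn.
have pm0 : 0 < m.+1%:R `^ (- b) by rewrite powR_gt0.
(* Solves [potential C m.+1 = |G|], so that the growth bound starts the induction. *)
pose C := (`|G| + D / m.+1%:R) / m.+1%:R `^ (- b).
have C0 : 0 < C by rewrite divr_gt0// ltr_wpDl// divr_gt0.
exists C, m; split=> // u z M n M1 uN uz mn zM.
have M0 : 0 < M by apply: lt_le_trans M1.
suff /(_ n mn zM) main : forall k, (m <= k)%N ->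
    (forall i, (1 <= i <= k)%N -> z i <= M) -> u k.+1 <= potential C k.+1 * M.
  apply: (le_trans main); rewrite mulrAC ler_wpM2r ?(ltW M0)// /potential.
  have n0 : 0 < n%:R :> R by rewrite ltr0n (leq_trans _ mn).
  apply: (@le_trans _ _ (C * n.+1%:R `^ (- b))).
    by rewrite lerBlDr lerDl divr_ge0// ltW.
  rewrite ler_wpM2l ?(ltW C0)// !powRN lef_pV2 ?posrE ?powR_gt0//.
  by rewrite ge0_ler_powR// ?nnegrE ?ler_nat.
elim=> // k IH; rewrite leq_eqVlt => /predU1P[<-|mk] zk.
  apply: le_trans (HG u z M M1 uN uz zk) _.
  rewrite ler_wpM2r ?(ltW M0)// /potential /C divfK ?gt_eqF// addrK.
  exact: ler_norm.
have k0 : 0 < k.+1%:R :> R by [].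
have mk' : m%:R <= k.+1%:R :> R by rewrite ler_nat ltnW.
have ib1 : 0 < 2 / (1 - b) by rewrite divr_gt0.
have ak : a / k.+1%:R <= 1 by rewrite ler_pdivrMr// mul1r; lra.
have bk : `|1 - a / k.+1%:R| + a * c / k.+1%:R = 1 - b / k.+1%:R.
  by rewrite ger0_norm ?subr_ge0// /b; field; rewrite gt_eqF.
have bk0 : 0 <= 1 - b / k.+1%:R.
  by rewrite -bk addr_ge0// divr_ge0// mulr_ge0// ltW.
apply: le_trans (uz k.+1 isT) _; rewrite bk.
have kb : 2 / (1 - b) <= k.+1%:R.
  by rewrite ltW// (lt_le_trans _ mk')// (lt_trans _ mab)// ltrDr.
have uk : u k.+1 <= potential C k.+1 * M.
  by apply: IH => // i /andP[i1 ik]; apply: zk; rewrite i1 leqW.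
have /(ler_wpM2r (ltW M0)) := potential_step (ltW C0) (ltn0Sn k) kb.
apply: le_trans.
rewrite [leRHS]mulrDl -[X in _ <= X + _]mulrA lerD ?ler_wpM2l//.
  by rewrite divr_ge0 ?exprn_ge0// ltW.
by apply: zk; rewrite leqnn.
Qed.

End perturbed_contraction.

(** * Summability of polynomial bounds *)

Lemma powR_series_lty (R : realType) (t : R) : 0 < t ->
  (\sum_(1 <= n <oo) (n%:R `^ (- (1 + t)))%:E < +oo)%E.
Proof.
move=> t0.
have pos n : (0 <= (n%:R `^ (- (1 + t)))%:E :> \bar R)%E.
  by rewrite lee_fin powR_ge0.
apply: (@le_lt_trans _ _ (1 + t^-1)%:E); last exact: ltry.
apply: lime_le; first exact: is_cvg_nneseries.
exists 2%N => // -[|[|n]] // _.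
(* Telescoping: the tangent at [k] evaluated at [k - 1] gives [k ^ (- 1 - t) <= ((k - 1) ^ (- t) - k
   ^ (- t)) / t] for [k >= 2]. *)
apply: (@le_trans _ _ (1 + (1 - n.+1%:R `^ (- t)) / t)%:E); last first.
  by rewrite lee_fin lerD2l ler_pdivrMr// mulVf ?gt_eqF// gerBl powR_ge0.
elim: n => [|n IH].
  by rewrite big_nat1 powR1 subrr mul0r addr0.
rewrite big_nat_recr//=; apply: (le_trans (leeD IH (lexx _))).
rewrite -EFinD lee_fin -addrA lerD2l -lerBrDl -mulrBl ler_pdivlMr//.
have n0 : 0 < n.+2%:R :> R by [].
have := @powRN_tangent R t n.+2%:R n.+1%:R (ltW t0) n0 (ltr0Sn _ _).
have -> : n.+1%:R - n.+2%:R = -1 :> R by rewrite -(natr1 n.+1); ring.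
rewrite [- (1 + t)]opprD powRD ?pnatr_eq0 ?implybT// powR_inv1//.
by move: (_ `^ _) (_ `^ _) (_^-1) => q r i; lra.
Qed.

Lemma nneseries_powR_bound_lty (R : realType) (u : nat -> \bar R) (t : R) n0 :
  0 < t -> (forall n, 0 <= u n)%E -> (forall n, u n < +oo)%E ->
  (forall n, (n0 <= n)%N -> u n <= (n%:R `^ (- (1 + t)))%:E)%E ->
  (\sum_(1 <= n <oo) u n < +oo)%E.
Proof.
move=> t0 u0 uoo ut.
rewrite (@nneseries_split _ _ 1 n0)//; apply: lte_add_pinfty.
  by apply: lte_sum_pinfty => i _; exact: uoo.
apply: (@le_lt_trans _ _ (\sum_(1 + n0 <= n <oo) (n%:R `^ (- (1 + t)))%:E)%E).
  rewrite [leLHS]eseries_cond [leRHS]eseries_cond.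
  apply: lee_nneseries => [n _ _|n]; first exact: u0.
  by move=> /andP[_ n0n]; apply/ut/(leq_trans _ n0n)/leq_addl.
apply: le_lt_trans (powR_series_lty t0).
rewrite [leRHS](@nneseries_split _ _ 1 n0); last first.
  by move=> n _; rewrite lee_fin powR_ge0.
by rewrite leeDr// sume_ge0// => n _; rewrite lee_fin powR_ge0.
Qed.

(** * Measurability and tail probabilities *)

Lemma contraction_continuous (R : realType) (f : R -> R) (c : R) : 0 < c ->
  (forall u v, `|f u - f v| <= c * `|u - v|) -> continuous f.
Proof.
move=> c0 fc u; apply/cvgrPdist_lt => e e0; near=> v.
apply: le_lt_trans (fc u v) _; rewrite mulrC -ltr_pdivlMr//.
by near: v; apply: cvgr_dist_lt; [exact: cvg_id|rewrite divr_gt0].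
Unshelve. all: by end_near. Qed.

Lemma measurable_normr_gt d (T : measurableType d) (R : realType) (g : T -> R)
    (t : R) : measurable_fun setT g -> measurable [set w | t < `|g w|].
Proof.
move=> mg; rewrite -preimage_true -[X in measurable X]setTI.
by apply: measurable_fun_ltr => //; exact: measurableT_comp.
Qed.

Lemma tail_union_bound d (T : measurableType d) (R : realType)
    (P : probability T R) (xi : nat -> {RV P >-> R}) (p t : R) (n : nat)
    (A : set T) :
  (forall i, (1 <= i)%N ->
     (P [set w | (t < `|xi i w|)%R] <= (t `^ (- p))%:E)%E) ->
  measurable A ->
  A `<=` [set w | exists2 i, (1 <= i <= n)%N & t < `|xi i w|] ->
  (P A <= (n%:R * t `^ (- p))%:E)%E.
Proof.
move=> tail mA sA.
pose F i := [set w | t < `|xi i.+1 w|].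
have mF i : measurable (F i) by exact: measurable_normr_gt.
apply: (@le_trans _ _ (\sum_(i < n) P (F i))%E).
  apply: content_subadditive => // w /sA[[|i] // /= iin ti].
  by rewrite -bigcup_mkord; exists i.
apply: (@le_trans _ _ (\sum_(i < n) (t `^ (- p))%:E)%E).
  by apply: lee_sum => i _; exact: tail.
by rewrite sumEFin sumr_const card_ord mulr_natl.
Qed.

Theorem theorem2 (disp : measure_display) (Omega : measurableType disp)
    (R : realType) (P : probability Omega R)
    (f : R -> R) (f_nonlinear : ~ linear (f : R^o -> R^o))
    (a x1 : R) (a_gt0 : 0 < a)
    (xi : nat -> {RV P >-> R})
    (x : nat -> Omega -> R)
    (x_init : forall w, x 1%N w = x1)
    (x_rec : forall n w, (1 <= n)%N ->
       x n.+1 w = (1 - a / n%:R) * x n w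
                  + a / n%:R * (f (x n w) + n%:R^-1 * xi n w))
    (c : R) (c_gt0 : 0 < c) (c_lt1 : c < 1)
    (f_contr : forall u v, `|f u - f v| <= c * `|u - v|)
    (xstar : R) (xstar_fix : f xstar = xstar)
    (xstar_uniq : forall u, f u = u -> u = xstar)
    (N : R) (N_gt0 : 0 < N) (x1_near : `|x1 - xstar| <= N)
    (p : R) (p_gt2 : 2 < p)
    (xi_tail : forall (t : R) (i : nat), 0 < t -> (1 <= i)%N ->
       (P [set w | (t < `|xi i w|)%R] <= (t `^ (- p))%:E)%E)
    (d beta : R) (d_ge1 : 1 <= d) (beta_gt1 : 1 < beta)
    (xi_mixing : forall n, (1 <= n)%N ->
       (alpha_mixing P (fun i => xi i : Omega -> R) n
          <= (d * n%:R `^ (- beta))%:E)%E)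
    (rho_exists : exists2 rho0 : R, 0 < rho0 &
       2 < rho0 * (((beta + 1) * p) / (beta + p))) :
  forall rho : R, 0 < rho ->
    2 * (beta + p) / (p * (beta + 1)) < rho ->
    rho < a * (1 - c) ->
    a * (1 - c) < 1 ->
    bigO_aco P (fun n w => x n.+1 w - xstar)
      (fun n => Num.sqrt (ln n%:R) / n%:R `^ (a * (1 - c) - rho)).
Proof.
move=> rho rho0 rhop rhob b1.
set b := a * (1 - c).
have b0 : 0 <= b by rewrite mulr_ge0 ?subr_ge0// ltW.
(* The lower bound on [rho] reads [rho p (beta + 1) > 2 (beta + p)], and [beta + p > beta + 1]. *)
have rp : 2 < rho * p.
  have bb : 0 < beta + 1 by lra.
  have pb : 0 < p * (beta + 1) by rewrite mulr_gt0//; lra.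
  move: rhop; rewrite ltr_pdivrMr// mulrA => rhop.
  rewrite -(ltr_pM2r bb); apply: lt_trans rhop.
  by rewrite ltr_pM2l//; lra.
have [C [n0 [C0 HC]]] := perturbed_contraction_rate N a_gt0 (ltW c_gt0) b0 b1.
have mf : measurable_fun setT f.
  by apply: continuous_measurable_fun; exact: contraction_continuous f_contr.
(* The shift avoids [x 0], which is unconstrained. *)
have mx n : measurable_fun setT (x n.+1).
  elim: n => [|n IH].
    by rewrite (_ : x 1%N = cst x1)//; apply/funext => w; rewrite x_init.
  rewrite (_ : x n.+2 = fun w => (1 - a / n.+1%:R) * x n.+1 w
      + a / n.+1%:R * (f (x n.+1 w) + n.+1%:R^-1 * xi n.+1 w)); last first.
    by apply/funext => w; rewrite x_rec.
  apply: measurable_funD; apply: measurable_funM => //.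
  apply: measurable_funD; first exact: measurableT_comp.
  exact: measurable_funM.
have mE (s : R) n : measurable [set w | s < `|x n.+1 w - xstar|].
  by apply: measurable_normr_gt; exact: measurable_funB.
have xc w : perturbed_contraction a c (fun n => `|x n w - xstar|)
    (fun n => `|xi n w|).
  move=> n n1; rewrite x_rec//.
  have n0' : 0 < n%:R :> R by rewrite ltr0n.
  have an0 : 0 <= a / n%:R by rewrite divr_ge0// ltW.
  (* Subtract [xstar = (1 - a / n) xstar + (a / n) f xstar]. *)
  have -> : (1 - a / n%:R) * x n w + a / n%:R * (f (x n w) + n%:R^-1 * xi n w)
      - xstar = (1 - a / n%:R) * (x n w - xstar)
      + a / n%:R * (f (x n w) - f xstar) + a / n%:R ^+ 2 * xi n w.
    by rewrite xstar_fix; field; rewrite gt_eqF.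
  apply: le_trans (ler_normD _ _) _; apply: lerD; last first.
    by rewrite normrM ger0_norm// divr_ge0 ?exprn_ge0// ltW.
  rewrite [leRHS]mulrDl; apply: le_trans (ler_normD _ _) _.
  rewrite (normrM (1 - _)) (normrM (a / _)) (ger0_norm an0) lerD//.
  by rewrite [a * c / _]mulrAC -[leRHS]mulrA ler_wpM2l.
pose t := rho * p - 2.
have t0 : 0 < t by rewrite subr_gt0.
(* From [n >= e] on, [sqrt (ln n) >= 1], so the logarithmic factor only enlarges the threshold. The
   finitely many earlier terms, among them [n = 1] where the threshold vanishes, are at most 1. *)
pose ne := (Num.truncn (expR 1 : R)).+1.
exists C => //; apply: (@nneseries_powR_bound_lty _ _ t (maxn n0 ne)) => //.
  by move=> n; apply: (le_lt_trans (probability_le1 P (mE _ _))); exact: ltry.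
move=> n; rewrite geq_max => /andP[n0n nen].
have en : expR 1 <= n%:R :> R.
  by rewrite (le_trans (ltW (truncnS_gt _)))// ler_nat.
have n1 : 1 <= n%:R :> R by rewrite (le_trans _ en)// ltW// expR_gt1.
have npos : 0 < n%:R :> R by apply: lt_le_trans n1.
have -> : n%:R `^ (- (1 + t)) = n%:R * (n%:R `^ rho) `^ (- p) :> R.
  rewrite -powRrM -[X in X * _]powRr1 ?(ltW npos)//.
  rewrite -powRD ?(gt_eqF npos) ?implybT//.
  by congr (_ `^ _); rewrite /t; ring.
apply: (@tail_union_bound _ _ _ _ xi).
- by move=> i i1; apply: xi_tail => //; rewrite powR_gt0.
- exact: mE.
(* By contraposition: if [|xi i w| <= n ^ rho] for all [i] from 1 to [n], the deterministic rate
   with [M = n ^ rho] keeps the error below the threshold. *)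
- move=> w /=; apply: contraPP => /forall2NP small; apply/negP.
  rewrite -leNgt.
  have M1 : 1 <= n%:R `^ rho by rewrite -[leLHS](powRr0 n%:R) ler_powR// ltW.
  have xiM i : (1 <= i <= n)%N -> `|xi i w| <= n%:R `^ rho.
    by move=> iin; rewrite leNgt; apply/negP; case: (small i).
  have x1N : `|x 1%N w - xstar| <= N by rewrite x_init.
  apply: le_trans (HC _ _ _ _ M1 x1N (xc w) n0n xiM) _.
  rewrite -mulrA ler_wpM2l ?(ltW C0)//.
  rewrite -powRN opprB -powRD ?(gt_eqF npos) ?implybT// ler_peMl ?powR_ge0//.
  rewrite -[leLHS]sqrtr1 ler_sqrt ?ln_ge0//.
  by rewrite -[leLHS](expRK 1) ler_ln ?posrE ?expR_gt0.
Qed.
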